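(* Let $G$ be an ordered group with identity $e$. (a) Every strong module of $G$ containing $e$ is a convex subgroup of $G$, and $\mathcal V(G)$ is a chain under inclusion. More precisely, the strong modules of $G$ containing $e$ are exactly the sets $$H_I:=\{e\}\cup\bigcup_{H\in I}H,$$ where $I$ is an initial segment of $\mathcal V(G)$ (possibly empty). Consequently every strong module of $G$ is a left coset of such a convex subgroup. (b) For every $H\in\mathcal V(G)$, the subgroup $H^-$ is proper, convex and normal in $H$. Its cosets in $H$ are the maximal proper strong submodules of $H$, and the quotient ordered group $Q_H:=H/H^-$ is prime, totally ordered, or equality-ordered. (c) If $g\ne e$ and $H=S(e,g)$, then the comparison of $g$ with $e$ in $G$ is determined by $gH^-$ in $Q_H$ (that is, $g>e$, $g<e$, or $g$ is incomparable with $e$ according as $gH^->H^-$, $gH^-<H^-$, or $gH^-$ is incomparable with $H^-$ in $Q_H$). Hence the order relation on $G$ is determined by the canonical chain $\mathcal V(G)$ together with its ordered quotients $Q_H$. Moreover, conjugation preserves the canonical decomposition of $G$: for all $a\in G$ and $H\in\mathcal V(G)$, one has $aHa^{-1}\in\mathcal V(G)$, $(aHa^{-1})^-=aH^-a^{-1}$, and conjugation by $a$ induces an isomorphism of ordered groups $Q_H\to Q_{aHa^{-1}}$.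
   Context: An ordered group is a group $G$ (written multiplicatively, identity $e$) equipped with a partial order $\le$ such that $x\le y$ implies $axb\le ayb$ for all $a,b,x,y\in G$. A module of a poset $(X,\le)$ is a subset $M\subseteq X$ such that for every $x\in X\setminus M$ and all $m,m'\in M$: $x\le m\iff x\le m'$ and $m\le x\iff m'\le x$. The empty set, the singletons and $X$ are the trivial modules; the poset is prime if it has no other module. A module $M$ is strong if it is nonempty and every module is disjoint from $M$, contained in $M$, or contains $M$. For $x,y\in X$, $S(x,y)$ is the intersection of all strong modules containing $x$ and $y$; it is the least strong module containing both. Modules of an ordered group are modules of its underlying poset; the strong submodules of $H$ are the strong modules of the induced poset on $H$, ''proper'' meaning different from $H$. A subset $C$ is convex if $a\le z\le b$ with $a,b\in C$ implies $z\in C$. For an ordered group $G$ put $\mathcal V(G):=\{S(e,g):g\in G,\ g\ne e\}$, ordered by inclusion, and for $H\in\mathcal V(G)$ put $H^-:=\{e\}\cup\bigcup\{K\in\mathcal V(G):K\subsetneq H\}$. An initial segment of a chain is a downward closed subset. If $N$ is a convex normal subgroup of an ordered group $H$, then $H/N$ is ordered by $\alpha\le\beta$ iff $a\le b$ for some $a\in\alpha$, $b\in\beta$; this makes $H/N$ an ordered group. Equality-ordered means that $x\le y$ holds only if $x=y$. *)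

(* Defs.v *)
From mathcomp Require Import all_boot.
From mathcomp Require Import boolp classical_sets functions.

Set Implicit Arguments.
Unset Strict Implicit.
Unset Printing Implicit Defensive.

Local Open Scope classical_set_scope.
Local Open Scope group_scope.

(* Posets and groups are given on a subset X of an ambient type, so that the
   same definitions apply to G, to the induced poset on a subset H of G, and to
   the quotients H / N, whose elements are cosets, i.e. subsets of G. *)

Section Relations.
Context {T : Type}.
Implicit Types (X C M N : set T) (le : T -> T -> Prop).

Definition partial_order_on X le : Prop :=
  [/\ forall x, X x -> le x x,
      forall x y, X x -> X y -> le x y -> le y x -> x = y &
      forall x y z, X x -> X y -> X z -> le x y -> le y z -> le x z].

Definition slt le (x y : T) : Prop := le x y /\ x <> y.

Definition incomparable le (x y : T) : Prop := ~ le x y /\ ~ le y x.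

Definition equality_ordered X le : Prop :=
  forall x y, X x -> X y -> le x y -> x = y.

Definition convex le C : Prop :=
  forall a z b, C a -> C b -> le a z -> le z b -> C z.

Definition is_module X le M : Prop :=
  M `<=` X /\
  forall x, (X `\` M) x -> forall m m', M m -> M m' ->
    (le x m <-> le x m') /\ (le m x <-> le m' x).

Definition trivial_module X M : Prop :=
  [\/ M = set0, exists2 x, X x & M = [set x] | M = X].

Definition is_prime X le : Prop :=
  forall M, is_module X le M -> trivial_module X M.

Definition strong_module X le M : Prop :=
  [/\ is_module X le M, M !=set0 &
      forall N, is_module X le N -> [\/ N `&` M = set0, N `<=` M | M `<=` N]].

Definition maximal_proper_strong X le : set (set T) :=
  [set M | [/\ strong_module X le M, M <> X &
    forall M', strong_module X le M' -> M' <> X -> M `<=` M' -> M' = M]].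

Definition strong_span X le (x y : T) : set T :=
  \bigcap_(M in [set M | [/\ strong_module X le M, M x & M y]]) M.

End Relations.

Section OrderedGroups.
Context {T : Type}.
Implicit Types (X : set T) (mul : T -> T -> T) (le : T -> T -> Prop).

Definition group_on X mul (one : T) : Prop :=
  [/\ forall x y, X x -> X y -> X (mul x y),
      forall x y z, X x -> X y -> X z -> mul x (mul y z) = mul (mul x y) z,
      X one /\ (forall x, X x -> mul one x = x /\ mul x one = x) &
      forall x, X x -> exists2 y, X y & mul x y = one /\ mul y x = one].

Definition group_order_on X mul le : Prop :=
  partial_order_on X le /\
  forall a b x y, X a -> X b -> X x -> X y ->
    le x y -> le (mul (mul a x) b) (mul (mul a y) b).

Definition ordered_group_on X mul (one : T) le : Prop :=
  group_on X mul one /\ group_order_on X mul le.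

End OrderedGroups.

Definition ordered_group_iso {T U : Type}
    (X : set T) (mul : T -> T -> T) (le : T -> T -> Prop)
    (Y : set U) (mul' : U -> U -> U) (le' : U -> U -> Prop) (f : T -> U) : Prop :=
  [/\ set_bij X Y f,
      forall x y, X x -> X y -> f (mul x y) = mul' (f x) (f y) &
      forall x y, X x -> X y -> (le x y <-> le' (f x) (f y))].

Section CanonicalChain.
Context {G : groupType}.
Implicit Types (H N A B : set G) (I V : set (set G)) (le : G -> G -> Prop).

Definition subgroup H : Prop := group_closed (mem H).

Definition lcoset (g : G) N : set G := [set g * x | x in N].

Definition conj (a x : G) : G := a * x * a^-1.

Definition normal_in N H : Prop :=
  [/\ subgroup N, N `<=` H & forall h, H h -> conj h @` N = N].

Definition quotient H N : set (set G) := [set lcoset h N | h in H].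

Definition setmul A B : set G := [set x * y | x in A & y in B].

Definition quotient_le le A B : Prop :=
  exists a b, [/\ A a, B b & le a b].

Definition canonical_chain le : set (set G) :=
  [set strong_span [set: G] le 1 g | g in [set g | g <> 1]].

Definition initial_segment I V : Prop :=
  I `<=` V /\ forall H K, I H -> V K -> K `<=` H -> I K.

Definition union1 I : set G := [set 1] `|` \bigcup_(H in I) H.

(* Usually written H^-; it depends on le only through canonical_chain le. *)
Definition lower le H : set G :=
  union1 [set K | canonical_chain le K /\ K `<` H].

End CanonicalChain.

(* Main.v *)
(** Translations, conjugations and inversion preserve or reverse the order, so
    they permute the strong modules.  Strong modules through a common point form
    a chain; as [S^-1] is strong for each [S = S(1,g)], it equals [S], and
    [S(1,g)^-1 = g^-1 S(1,g)] then gives [g S = S], from which strong modules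
    containing [1] are subgroups.

    Distinct cosets of [H^-] compare through any representatives, so strong
    modules of [H / H^-] pull back to strong modules of [H], and [H / H^-] has
    only trivial strong modules.  A poset with only trivial strong modules and a
    nontrivial module splits into two nonempty parts [A], [X \ A] such that all
    cross pairs are comparable, or all are incomparable.  The connected
    components of the (in)comparability graph are strong modules, hence
    singletons for the relation that does not cross: the poset is a chain or an
    antichain. *)

Require Import Defs.
From mathcomp Require Import all_boot.
From mathcomp Require Import boolp classical_sets functions.

Local Open Scope classical_set_scope.
Local Open Scope group_scope.

(** * Modules and strong modules of a relation on a set *)

Section Modules.
Context {T : Type} {X : set T} {le : T -> T -> Prop}.
Implicit Types (M N P E : set T) (F : set (set T)) (x y m c : T).

(** The module condition at a single outside point, isolated because it can be chained in its last
    two arguments. *)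
Definition alike (x m m' : T) : Prop :=
  (le x m <-> le x m') /\ (le m x <-> le m' x).

Lemma alike_sym {x m m'} : alike x m m' -> alike x m' m.
Proof. by rewrite /alike => -[-> ->]. Qed.

Lemma alike_trans {x m1} m2 {m3} : alike x m1 m2 -> alike x m2 m3 -> alike x m1 m3.
Proof. by rewrite /alike => -[-> ->]. Qed.

Lemma module_sub {M x} : is_module X le M -> M x -> X x.
Proof. by case=> + _; apply. Qed.

Lemma module_alike {M x m m'} :
  is_module X le M -> X x -> ~ M x -> M m -> M m' -> alike x m m'.
Proof. by case=> _ MP Xx Mx; apply: MP. Qed.

Lemma module_full : is_module X le X.
Proof. by split=> // x []. Qed.

Lemma module_set1 x : X x -> is_module X le [set x].
Proof. by move=> Xx; split=> [_ -> //|y _ m m' -> ->]. Qed.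

Lemma module_bigcap F : F !=set0 -> (forall M, F M -> is_module X le M) ->
  is_module X le (\bigcap_(M in F) M).
Proof.
move=> [M0 FM0] modF; split=> [x /(_ _ FM0)|x [Xx Fx] m m' Fm Fm'].
  exact: module_sub (modF _ FM0).
have [M /not_implyP[FM Mx]] : exists M, ~ (F M -> M x).
  by apply: contrapT => /forallNP FP; apply: Fx => M FM; exact: (contrapT (FP M)).
exact: module_alike (modF _ FM) Xx Mx (Fm _ FM) (Fm' _ FM).
Qed.

(** Seen from outside the union, every point of a member is alike to the common point [c]. *)
Lemma module_bigcup c F : (forall M, F M -> is_module X le M /\ M c) ->
  is_module X le (\bigcup_(M in F) M).
Proof.
move=> modF; split=> [x [M /modF[modM _]]|]; first exact: module_sub.
have aux x m : X x -> ~ (\bigcup_(M in F) M) x -> (\bigcup_(M in F) M) m -> alike x m c.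
  move=> Xx Fx [M FM Mm]; have [modM Mc] := modF _ FM.
  by apply: module_alike modM Xx _ Mm Mc => Mx; apply: Fx; exists M.
move=> x [Xx Fx] m m' Fm Fm'.
exact: (alike_trans _ (aux _ _ Xx Fx Fm) (alike_sym (aux _ _ Xx Fx Fm'))).
Qed.

Lemma module_setU M N : is_module X le M -> is_module X le N -> M `&` N !=set0 ->
  is_module X le (M `|` N).
Proof.
move=> modM modN [c [Mc Nc]].
have -> : M `|` N = \bigcup_(P in [set M; N]) P by rewrite bigcup_setU !bigcup_set1.
by apply: (@module_bigcup c) => P [->|->].
Qed.

(** The new case is [x] in both modules. A point [n] of [N] outside [M] stands in for it: [m] and
    [m'] do not separate [x] from [n], and [n] does not separate [m] from [m']. *)
Lemma module_setD M N : is_module X le M -> is_module X le N -> N `\` M !=set0 ->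
  is_module X le (M `\` N).
Proof.
move=> modM modN [n [Nn Mn]]; split=> [x [Mx _]|x [Xx xMN] m m' [Mm Nm] [Mm' Nm']].
  exact: module_sub modM Mx.
have [Mx|Mx] := pselect (M x); last exact: module_alike modM Xx Mx Mm Mm'.
have Nx : N x by apply: contrapT => Nx; apply: xMN.
have Xn := module_sub modN Nn.
have [a1 a2] := module_alike modN (module_sub modM Mm) Nm Nx Nn.
have [b1 b2] := module_alike modN (module_sub modM Mm') Nm' Nx Nn.
have [c1 c2] := module_alike modM Xn Mn Mm Mm'.
by split; [rewrite a2 b2|rewrite a1 b1].
Qed.

Lemma strong_full : X !=set0 -> strong_module X le X.
Proof.
by move=> X0; split=> // [|N [NX _]]; [exact: module_full|exact: Or32].
Qed.

Lemma strong_set1 x : X x -> strong_module X le [set x].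
Proof.
move=> Xx; split=> [||N modN]; [exact: module_set1|by exists x|].
have [Nx|Nx] := pselect (N x); first by apply: Or33 => _ ->.
by apply: Or31; apply/seteqP; split=> // y [Ny /= yx]; apply: Nx; rewrite -yx.
Qed.

Lemma strong_case M N : strong_module X le M -> is_module X le N ->
  N `&` M !=set0 -> N `<=` M \/ M `<=` N.
Proof.
move=> [_ _ sM] /sM[NM0|NM|MN] NM_; [|by left|by right].
by case: NM_ => x; rewrite NM0.
Qed.

Lemma strong_chain x M N : strong_module X le M -> strong_module X le N ->
  M x -> N x -> M `<=` N \/ N `<=` M.
Proof.
move=> [modM _ _] sN Mx Nx; apply: strong_case => //; by exists x.
Qed.

Lemma strong_moduleI M : is_module X le M -> M !=set0 ->
  (forall N, is_module X le N -> N `&` M !=set0 -> ~ N `<=` M -> M `<=` N) ->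
  strong_module X le M.
Proof.
move=> modM M0 MP; split=> // N modN.
have [NM0|/set0P/negP/negPn/eqP NM] := pselect (N `&` M !=set0); last first.
  exact: Or31.
by have [NM|NM] := pselect (N `<=` M); [exact: Or32|apply: Or33; exact: MP].
Qed.

(** A module that meets one member and is not inside the union must contain that member, hence [c],
    hence meets and contains every other member. *)
Lemma strong_bigcup c F : F !=set0 ->
  (forall M, F M -> strong_module X le M /\ M c) ->
  strong_module X le (\bigcup_(M in F) M).
Proof.
move=> [M0 FM0] sF; apply: strong_moduleI.
- by apply: (@module_bigcup c) => M /sF[[]].
- by exists c, M0 => //; have [] := sF _ FM0.
move=> N modN [x [Nx [M FM Mx]]] NF.
have sub M' : F M' -> N `&` M' !=set0 -> M' `<=` N.
  move=> FM' NM'; have [sM' _] := sF _ FM'.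
  have [NsM'|//] := strong_case _ _ sM' modN NM'.
  by exfalso; apply: NF => y Ny; exists M' => //; exact: NsM'.
have Nc : N c by apply: (sub M FM); [exists x|have [] := sF _ FM].
move=> y [M' FM' M'y]; apply: (sub M' FM') => //.
by exists c; split=> //; have [] := sF _ FM'.
Qed.

(** A module not inside the intersection is not inside some strong [M] of the family; since it meets
    [M], it contains [M] and so the intersection. *)
Lemma strong_span_strong x y : X x -> X y -> strong_module X le (strong_span X le x y).
Proof.
move=> Xx Xy; have FX : [set M | [/\ strong_module X le M, M x & M y]] X.
  by split=> //; apply: strong_full; exists x.
apply: strong_moduleI.
- by apply: module_bigcap => [|M [[]]]; first by exists X.
- by exists x => M [].
move=> N modN [z [Nz Sz]] NS.
have [M FM] : exists M, ~ ([/\ strong_module X le M, M x & M y] -> N `<=` M).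
  apply: contrapT => /forallNP NP; apply: NS => w Nw M FM.
  exact: (contrapT (NP M)).
case/not_implyP: FM => FM NM w Sw; have [sM _ _] := FM.
have [//|MN] : N `<=` M \/ M `<=` N.
  by apply: strong_case => //; exists z; split=> //; exact: Sz.
by apply: MN; exact: Sw.
Qed.

Lemma strong_span_l x y : strong_span X le x y x.
Proof. by move=> M []. Qed.

Lemma strong_span_r x y : strong_span X le x y y.
Proof. by move=> M []. Qed.

Lemma strong_span_sub {x y} M : strong_module X le M -> M x -> M y ->
  strong_span X le x y `<=` M.
Proof. by move=> sM Mx My z; apply. Qed.

(* Impredicative form of the class of [u] for the equivalence generated by [R] on [X]. *)
Definition component (R : T -> T -> Prop) (u : T) : set T :=
  [set v | forall P : set T, P u ->
    (forall a b, P a -> X b -> R a b -> P b) -> P v].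

(** An outside point is unrelated to the whole component, so alikeness passes along the edges. A
    module [N] with a point [n] outside the component is closed under edges inside it: an edge from
    [a] in [N] to [b] not in [N] would relate [b] to [n]. *)
Lemma component_strong (R : T -> T -> Prop) u :
  (forall x y, R x y -> R y x) ->
  (forall x a b, X x -> X a -> X b -> R a b -> ~ R x a -> ~ R x b -> alike x a b) ->
  (forall x a b, alike x a b -> R x a -> R x b) ->
  X u -> strong_module X le (component R u).
Proof.
move=> Rsym Ralike alikeR Xu.
have Cu : component R u u by [].
have Cstep a b : component R u a -> X b -> R a b -> component R u b.
  by move=> Ca Xb Rab P Pu Pstep; apply: (Pstep a) => //; exact: Ca.
have CX v : component R u v -> X v by apply.
(* Induction that also remembers membership in the component, by intersecting the predicate with
   it. *)
have Cind P v : component R u v -> P u ->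
    (forall a b, component R u a -> P a -> X b -> R a b -> P b) -> P v.
  move=> Cv Pu Pstep; suff [] : (component R u `&` P) v by [].
  apply: Cv => // a b [Ca Pa] Xb Rab.
  by split; [exact: (Cstep a)|exact: (Pstep a)].
apply: strong_moduleI; [split=> // x [Xx Cx] | by exists u | ].
  have NR v : component R u v -> ~ R x v.
    by move=> Cv /Rsym Rvx; apply: Cx; exact: (Cstep v).
  have aux v : component R u v -> alike x u v.
    move=> Cv; apply: (Cind _ _ Cv) => // a b Ca uaP Xb Rab.
    apply: (alike_trans a) => //; apply: Ralike => //; first exact: CX.
      exact: NR.
    by apply: NR; exact: (Cstep a).
  by move=> m m' Cm Cm'; exact: (alike_trans u (alike_sym (aux _ Cm)) (aux _ Cm')).
move=> N modN [c [Nc Cc]] /nonsubset[n [Nn Cn]].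
have Xn := module_sub modN Nn.
have Nstep a b : component R u a -> component R u b -> R a b -> N a -> N b.
  move=> Ca Cb Rab Na; apply: contrapT => Nb; apply: Cn.
  apply: (Cstep b) => //; apply: (alikeR b a n); last exact: Rsym.
  exact: module_alike modN (CX _ Cb) Nb Na Nn.
(* Membership in [N] travels back from [c] to [u] by induction on the implication [N v -> N u]. *)
have Nu : N u.
  have: N c -> N u; last exact.
  apply: (Cind (fun v => N v -> N u) c Cc) => // a b Ca NaP Xb Rab Nb; apply: NaP.
  by apply: (Nstep b) => //; [exact: (Cstep a)|exact: Rsym].
move=> v Cv; apply: (Cind N v Cv) => // a b Ca Na Xb Rab.
by apply: (Nstep a) => //; exact: (Cstep a).
Qed.

(** * Comparability components and the trichotomy *)

Definition comparable (x y : T) : Prop := le x y \/ le y x.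

Lemma comparable_sym x y : comparable x y -> comparable y x.
Proof. by case; [right|left]. Qed.

Lemma comparableC x y : comparable x y <-> comparable y x.
Proof. by split; exact: comparable_sym. Qed.

Lemma comparable_alike x a b : alike x a b -> comparable x a <-> comparable x b.
Proof. by rewrite /alike /comparable => -[-> ->]. Qed.

Lemma comparability_component_strong u : X u ->
  strong_module X le (component comparable u).
Proof.
apply: component_strong; first exact: comparable_sym.
  move=> x a b _ _ _ _ /not_orP[xa ax] /not_orP[xb bx].
  by split; split.
by move=> x a b /comparable_alike ->.
Qed.

(** A point comparable to both of two incomparable points lies on the same side of both, by
    transitivity. *)
Lemma incomparability_component_strong u : partial_order_on X le -> X u ->
  strong_module X le (component (fun x y => ~ comparable x y) u).
Proof.
move=> [_ _ trans]; apply: component_strong.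
- by move=> x y xy /comparable_sym.
- move=> x a b Xx Xa Xb nab /contrapT xa /contrapT xb; split; split=> h.
  + by case: xb => // bx; exfalso; apply: nab; right; exact: (trans b x a).
  + by case: xa => // ax; exfalso; apply: nab; left; exact: (trans a x b).
  + by case: xb => // xb; exfalso; apply: nab; left; exact: (trans a x b).
  + by case: xa => // xa; exfalso; apply: nab; right; exact: (trans b x a).
- by move=> x a b /comparable_alike ->.
Qed.

(* [A] is the largest module containing [x]
   but not [y]; the union [D] of the modules meeting but not containing [A]
   is strong, hence equal to [X], and each of its members leaving [A] passes
   through [y]. *)
Lemma bipartition_of_module M x y :
  (forall N, strong_module X le N -> N = X \/ exists z, N = [set z]) ->
  is_module X le M -> (exists2 x', M x' & x' <> x) -> M x -> X y -> ~ M y ->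
  exists A : set T, [/\ A `<=` X, A x, ~ A y &
    forall a z, A a -> X z -> ~ A z -> comparable a z <-> comparable x y].
Proof.
move=> strongX modM [x' Mx' x'x] Mx Xy My.
pose F := [set N | [/\ is_module X le N, N x & ~ N y]].
pose A := \bigcup_(N in F) N.
have modA : is_module X le A by apply: (@module_bigcup x) => N [].
have AX : A `<=` X by case: modA.
(* Maximality of [A]: adjoining to it a module that meets it and avoids [y] gives a member of
   [F]. *)
have subA N : is_module X le N -> N `&` A !=set0 -> ~ N y -> N `<=` A.
  move=> modN [c [Nc Ac]] Ny z Nz; exists (N `|` A); last by left.
  split; first by apply: module_setU => //; exists c.
    by right; exists M.
  by case=> // -[K []].
have Ax : A x by exists M.
have Ax' : A x' by exists M.
have Ay : ~ A y by case=> N [].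
pose FD := [set N | [/\ is_module X le N, N `&` A !=set0 & ~ A `<=` N]].
pose D := \bigcup_(N in FD) N.
(* Singletons inside [A] belong to [FD], because [A] has the two points [x] and [x']. *)
have AD : A `<=` D.
  move=> a Aa; exists [set a] => //; split; first by apply: module_set1; exact: AX.
    by exists a.
  by move=> Aa1; apply: x'x; rewrite (Aa1 _ Ax) (Aa1 _ Ax').
(* Members of [FD] may share no point; enlarging each by [A] leaves the union unchanged and makes
   all of them contain [x]. *)
have modD : is_module X le D.
  have -> : D = \bigcup_(P in [set A `|` N | N in FD]) P.
    apply/seteqP; split=> [z [N FN Nz]|z [_ [N FN <-] [Az|Nz]]].
    - by exists (A `|` N); [exists N|right].
    - exact: AD.
    - by exists N.
  apply: (@module_bigcup x) => _ [N [modN [c [Nc Ac]] _] <-]; split; last by left.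
  by apply: module_setU => //; exists c.
have sD : strong_module X le D.
  apply: strong_moduleI => //; first by exists x; exact: AD.
  move=> E modE [z [Ez [N [modN [c [Nc Ac]] NA] Nz]]] ED.
  (* If [E] missed [A], the union of [E] and [N] would belong to [FD] and put [E] inside [D]. *)
  have EA : E `&` A !=set0.
    apply: contrapT => EA; apply: ED => w Ew; exists (E `|` N); last by left.
    split; first by apply: module_setU => //; exists z.
      by exists c; split=> //; right.
    move=> AEN; apply: NA => a Aa; case: (AEN a Aa) => // Ea.
    by exfalso; apply: EA; exists a.
  have AE : A `<=` E.
    by apply: contrapT => AE; apply: ED => w Ew; exists E.
  move=> w [N' FN' N'w]; apply: contrapT => Ew; apply: ED.
  have [modN' [c' [N'c' Ac']] N'A] := FN'.
  have [N'y|N'y] := pselect (N' y); last first.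
    by exfalso; apply: Ew; apply: AE; apply: (subA N') N'w => //; exists c'.
  (* This difference is a module because [w] is in [N'] but not in [E]; it avoids [y] and meets [A].
     Hence [E] would be covered by [N'] and [A], both inside [D]. *)
  have EN'A : E `\` N' `<=` A.
    apply: subA => [||[]//]; first by apply: module_setD => //; exists w.
    by have [a [Aa N'a]] := nonsubset N'A; exists a; split=> //; split=> //; exact: AE.
  move=> v Ev; have [N'v|N'v] := pselect (N' v); first by exists N'.
  by apply: AD; exact: EN'A.
have DX : D = X.
  have [//|[z Dz]] := strongX _ sD; exfalso; apply: x'x.
  have : [set z] x by rewrite -Dz; exact: AD.
  have : [set z] x' by rewrite -Dz; exact: AD.
  by move=> -> ->.
exists A; split=> // a z Aa Xz Az.
have [N [modN NA AN] Nz] : D z by rewrite DX.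
have Ny : N y by apply: contrapT => Ny; apply: Az; apply: (subA N) Nz.
(* The pair [(a, z)] is moved to [(b, z)], then [(b, y)], then [(x, y)], each move inside [A] or [N]
   and seen from a point outside it. *)
have [b [Ab Nb]] := nonsubset AN.
have h1 : comparable z a <-> comparable z b.
  by apply: comparable_alike; exact: module_alike modA Xz Az Aa Ab.
have h2 : comparable b z <-> comparable b y.
  by apply: comparable_alike; exact: module_alike modN (AX _ Ab) Nb Nz Ny.
have h3 : comparable y b <-> comparable y x.
  by apply: comparable_alike; exact: module_alike modA Xy Ay Ab Ax.
apply: iff_trans (comparableC a z) _; apply: iff_trans h1 _.
apply: iff_trans (comparableC z b) _; apply: iff_trans h2 _.
apply: iff_trans (comparableC b y) _; apply: iff_trans h3 _.
exact: comparableC.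
Qed.

Lemma component_separated (R : T -> T -> Prop) (A : set T) u v :
  (forall a b, X a -> X b -> R a b -> A a <-> A b) -> X u ->
  component R u v -> A u <-> A v.
Proof.
move=> RA Xu /(_ [set w | X w /\ (A u <-> A w)])[] // a b [Xa Aua] Xb Rab.
by split=> //; apply: iff_trans Aua _; exact: RA.
Qed.

Lemma strong_trivial_trichotomy :
  partial_order_on X le ->
  (forall M, strong_module X le M -> M = X \/ exists z, M = [set z]) ->
  [\/ is_prime X le, total_on X le | equality_ordered X le].
Proof.
move=> poX strongX; have [pX|] := pselect (is_prime X le); first exact: Or31.
move=> /existsNP[M /not_implyP[modM ntM]].
have MX : M `<=` X by case: modM.
have [x Mx] : M !=set0.
  by apply: contrapT => /nonemptyPn M0; apply: ntM; exact: Or31.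
have [x' Mx' x'x] : exists2 x', M x' & x' <> x.
  apply: contrapT => nx'; apply: ntM; apply: Or32; exists x; first exact: MX.
  apply/seteqP; split=> [z Mz|z ->//]; apply: contrapT => zx; apply: nx'.
  by exists z.
have [y [Xy My]] : (X `\` M) !=set0.
  by apply: nonsubset => XM; apply: ntM; apply: Or33; apply/seteqP.
have [A [AX Ax Ay Ar]] : exists A : set T, [/\ A `<=` X, A x, ~ A y &
    forall a z, A a -> X z -> ~ A z -> comparable a z <-> comparable x y].
  by apply: (bipartition_of_module M) => //; exists x'.
have Xx := AX _ Ax.
(* A component equal to [X] would contain both [x] and [y], although no edge crosses from [A] to its
   complement; so every component is a singleton. *)
have discrete (R : T -> T -> Prop) : (forall a z, A a -> X z -> ~ A z -> ~ R a z) ->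
    (forall a b, R a b -> R b a) ->
    (forall u, X u -> strong_module X le (component R u)) ->
    forall u v, X u -> X v -> R u v -> u = v.
  move=> RA Rsym sR u v Xu Xv Ruv.
  have sep w z : X w -> component R w z -> A w <-> A z.
    apply: component_separated => a b Xa Xb Rab; split=> [Aa|Ab]; apply: contrapT => nA.
      exact: (RA a b).
    exact: (RA b a) (Rsym _ _ Rab).
  have [CX|[z Cz]] := strongX _ (sR u Xu).
    have [Au|Au] := pselect (A u).
      by exfalso; apply: Ay; apply/(sep u) => //; rewrite CX.
    by exfalso; apply: Au; apply/(sep u x) => //; rewrite CX.
  have : component R u u by [].
  have : component R u v by move=> P Pu Pstep; exact: (Pstep u).
  by rewrite Cz => -> ->.
(* All cross pairs behave like [(x, y)], so exactly one of comparability and incomparability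
   crosses; [discrete] applies to the other. *)
have [xy|xy] := pselect (comparable x y).
  apply: Or32 => u v Xu Xv; apply: contrapT => uv.
  suff uv_ : u = v by apply: uv; left; rewrite uv_; case: poX => + _ _; exact.
  apply: (discrete (fun x y => ~ comparable x y)) => //.
  - by move=> a z Aa Xz Az; apply; apply/(Ar a z).
  - by move=> a b ab /comparable_sym.
  - by move=> w; exact: incomparability_component_strong.
apply: Or33 => u v Xu Xv uv; apply: (discrete comparable) => //; last by left.
- by move=> a z Aa Xz Az /(Ar a z Aa Xz Az).
- exact: comparable_sym.
- exact: comparability_component_strong.
Qed.

End Modules.

(** As [H] is a module, the modules of [H] are the modules of [X] inside [H]. As [H] is strong, any
    other module of [X] that meets [H] contains it. *)
Lemma strong_submodule {T : Type} (X : set T) (le : T -> T -> Prop) (H M : set T) :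
  strong_module X le H ->
  strong_module H le M <-> strong_module X le M /\ M `<=` H.
Proof.
move=> sH; have [modH H0 _] := sH.
have subX N : is_module H le N -> is_module X le N.
  move=> modN; split=> [x /(module_sub modN)/(module_sub modH)//|x [Xx Nx] m m' Nm Nm'].
  have [Hx|Hx] := pselect (H x); first exact: module_alike modN Hx Nx Nm Nm'.
  exact: module_alike modH Xx Hx (module_sub modN Nm) (module_sub modN Nm').
have subH N : is_module X le N -> N `<=` H -> is_module H le N.
  move=> modN NH; split=> // x [Hx Nx] m m'.
  exact: (module_alike modN (module_sub modH Hx)).
split=> [sM|[sM MH]].
  have [modM M0 sM'] := sM; have MH : M `<=` H by case: modM.
  split=> //; apply: strong_moduleI => // [|N modN NM NsM]; first exact: subX.
  have [NH|HN] : N `<=` H \/ H `<=` N; last exact: subset_trans MH HN.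
    apply: (strong_case _ _ sH modN); have [z [Nz Mz]] := NM.
    by exists z; split=> //; exact: MH.
  by have [//|//] := strong_case _ _ sM (subH N modN NH) NM.
have [modM M0 _] := sM; apply: strong_moduleI => // [|N modN NM NsM]; first exact: subH.
by have [//|//] := strong_case _ _ sM (subX N modN) NM.
Qed.

(** * Order automorphisms and anti-automorphisms *)

Section OrderSymmetry.
Context {T : Type} {le : T -> T -> Prop}.
Implicit Types (f : T -> T) (M : set T).

(** Both variances are allowed so that inversion is treated together with translations and
    conjugations; the inverse is given explicitly. *)
Definition order_symmetry f f' : Prop :=
  [/\ cancel f f', cancel f' f &
    (forall x y, le (f x) (f y) <-> le x y) \/
    (forall x y, le (f x) (f y) <-> le y x)].

Lemma order_symmetryV {f f'} : order_symmetry f f' -> order_symmetry f' f.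
Proof.
by move=> [fK f'K H]; split=> //; case: H => H; [left|right] => x y; rewrite -H !f'K.
Qed.

Lemma image_cancelE {f f'} M : cancel f f' -> cancel f' f -> f @` M = f' @^-1` M.
Proof.
move=> fK f'K; apply/seteqP; split=> [_ [x Mx <-]|x Mx]; first by rewrite /= fK.
by exists (f' x).
Qed.

(** Reversing the order only swaps the two equivalences in the definition of a module. *)
Lemma module_image {f f'} M : order_symmetry f f' ->
  is_module [set: T] le M -> is_module [set: T] le (f @` M).
Proof.
move=> sf modM; have [f'K fK H] := order_symmetryV sf.
rewrite (image_cancelE M fK f'K); split=> // x [_ Mx] m m' Mm Mm'.
have := module_alike modM (I : [set: T] (f' x)) Mx Mm Mm'.
by case: H => H [h1 h2]; split; move: h1 h2; rewrite !H.
Qed.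

Lemma strong_image {f f'} M : order_symmetry f f' ->
  strong_module [set: T] le M -> strong_module [set: T] le (f @` M).
Proof.
move=> sf sM; have [modM [m Mm] _] := sM; have [fK f'K _] := sf.
apply: strong_moduleI; [exact: module_image sf modM|by exists (f m), m|].
move=> N modN [z [Nz [x Mx fx]]] NM; rewrite -{}fx in Nz.
have [f'NM|Mf'N] : f' @` N `<=` M \/ M `<=` f' @` N.
  apply: (strong_case _ _ sM); first exact: module_image (order_symmetryV sf) modN.
  by exists x; split=> //; exists (f x).
  by exfalso; apply: NM => y Ny; exists (f' y) => //; apply: f'NM; exists y.
by move=> _ [y /Mf'N[w Nw <-] <-]; rewrite f'K.
Qed.

(** One inclusion is minimality of the span; the other is the same inclusion for the inverse
    symmetry. *)
Lemma strong_span_image {f f'} x y : order_symmetry f f' ->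
  f @` strong_span [set: T] le x y = strong_span [set: T] le (f x) (f y).
Proof.
have sub g g' u v : order_symmetry g g' ->
    strong_span [set: T] le (g u) (g v) `<=` g @` strong_span [set: T] le u v.
  move=> sg; apply: strong_span_sub; last 2 first.
  - by exists u => //; exact: strong_span_l.
  - by exists v => //; exact: strong_span_r.
  exact: (strong_image _ sg (strong_span_strong _ _ _ _)).
move=> sf; have [fK f'K _] := sf; apply/seteqP; split; last exact: (sub f f').
move=> _ [z Sz <-]; have := sub _ _ (f x) (f y) (order_symmetryV sf) z.
by rewrite !fK => /(_ Sz)[w Sw <-]; rewrite f'K.
Qed.

End OrderSymmetry.
Arguments order_symmetry {T} le f f'.

(** * Cosets, conjugation and subgroups as sets *)

Section Cosets.
Context {G : groupType}.
Implicit Types (M N H : set G) (a b g x : G).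

Lemma lcosetE g M x : lcoset g M x <-> M (g^-1 * x).
Proof.
by split=> [[y My <-]|Mx]; [rewrite mulKg|exists (g^-1 * x) => //; rewrite mulVKg].
Qed.

Lemma lcosetM a b M : lcoset a (lcoset b M) = lcoset (a * b) M.
Proof.
by apply/seteqP; split=> x /lcosetE; [move=> /lcosetE H; apply/lcosetE|
  move=> H; apply/lcosetE/lcosetE]; move: H; rewrite invgM mulgA.
Qed.

Lemma lcoset1 M : lcoset 1 M = M.
Proof. by apply/seteqP; split=> x; rewrite lcosetE invg1 mul1g. Qed.

Lemma conjK a : cancel (conj a) (conj a^-1).
Proof. by move=> x; rewrite /conj invgK !mulgA mulVg mul1g mulgVK. Qed.

Lemma conjVK a : cancel (conj a^-1) (conj a).
Proof. by move=> x; rewrite -{2}(conjK a^-1 x) invgK. Qed.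

Lemma conjM a x y : conj a (x * y) = conj a x * conj a y.
Proof. by rewrite /conj !mulgA mulgVK. Qed.

Lemma conj1 a : conj a 1 = 1.
Proof. by rewrite /conj mulg1 mulgV. Qed.

Lemma conj_image_lcoset a g M : conj a @` lcoset g M = lcoset (conj a g) (conj a @` M).
Proof.
apply/seteqP; split=> [_ [_ [x Mx <-] <-]|_ [_ [x Mx <-] <-]].
  by exists (conj a x); [exists x|rewrite conjM].
by exists (g * x); [exists x|rewrite conjM].
Qed.

Lemma subgroupP H : subgroup H <-> H 1 /\ forall x y, H x -> H y -> H (x^-1 * y).
Proof.
split=> [HG|[H1 Hd]].
  have [/set_mem H1 _] := HG; split=> // x y Hx Hy.
  by apply/set_mem/(group_closedM HG); [apply: (group_closedV HG)|]; exact/mem_set.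
have HV x : H x -> H x^-1 by move=> Hx; rewrite -[x^-1]mulg1; exact: Hd.
split; first exact/mem_set.
move=> x y /set_mem Hx /set_mem Hy; apply/mem_set.
by rewrite -[x]invgK; apply: Hd; exact: HV.
Qed.

Lemma subgroup1 {H} : subgroup H -> H 1.
Proof. by case/subgroupP. Qed.

Lemma subgroupV {H x} : subgroup H -> H x -> H x^-1.
Proof. by case/subgroupP => H1 Hd Hx; rewrite -[x^-1]mulg1; exact: Hd. Qed.

Lemma subgroupM {H x y} : subgroup H -> H x -> H y -> H (x * y).
Proof.
move=> HG Hx Hy; rewrite -[x]invgK; have /subgroupP[_ Hd] := HG.
by apply: Hd => //; exact: subgroupV.
Qed.

Lemma lcoset_self {N} g : subgroup N -> lcoset g N g.
Proof. by move=> NG; rewrite lcosetE mulVg; exact: subgroup1. Qed.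

Lemma lcoset_eq {N g x} : subgroup N -> lcoset g N x -> lcoset x N = lcoset g N.
Proof.
move=> NG [n Nn <-]; rewrite -lcosetM; congr lcoset.
apply/seteqP; split=> [_ [m Nm <-]|m Nm]; first exact: subgroupM.
by apply/lcosetE; apply: subgroupM => //; exact: subgroupV.
Qed.

Lemma setmul_lcoset {H N} a b : normal_in N H -> H b ->
  setmul (lcoset a N) (lcoset b N) = lcoset (a * b) N.
Proof.
move=> [NG NH nN] Hb; apply/seteqP; split.
  move=> _ [_ [m Nm <-]] [_ [n Nn <-] <-]; apply/lcosetE.
  (* Normality writes [m] as [b * k * b^-1], so that [a * m * b * n] becomes [a * b * k * n]. *)
  have [k Nk <-] : (conj b @` N) m by rewrite nN.
  rewrite /conj !mulgA invgM mulgVK -!mulgA (mulgA a^-1) mulVg mul1g.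
  by rewrite mulKg; exact: subgroupM.
move=> _ [n Nn <-]; exists a; first exact: lcoset_self.
by exists (b * n); [exists n|rewrite mulgA].
Qed.

End Cosets.

(** * Strong modules of an ordered group *)

Section OrderedGroupModules.
Context {G : groupType} {le : G -> G -> Prop}.
Hypothesis le_G : group_order_on [set: G] *%g le.
Implicit Types (M N H K : set G) (a b g x : G).

Local Notation strong := (strong_module [set: G] le).
Local Notation S := (strong_span [set: G] le 1).
Local Notation V := (canonical_chain le).

Lemma order_refl x : le x x.
Proof. by have [[refl _ _] _] := le_G; exact: refl. Qed.

Lemma order_antisym x y : le x y -> le y x -> x = y.
Proof. by have [[_ asym _] _] := le_G; exact: asym. Qed.

Lemma order_trans y x z : le x y -> le y z -> le x z.
Proof. by have [[_ _ trans] _] := le_G; exact: trans. Qed.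

Lemma order_mul a b x y : le x y -> le (a * x * b) (a * y * b).
Proof. by have [_ mono] := le_G; exact: mono. Qed.

Lemma order_mull a x y : le (a * x) (a * y) <-> le x y.
Proof.
split=> [/(order_mul a^-1 1)|/(order_mul a 1)]; rewrite !mulg1 //.
by rewrite !mulKg.
Qed.

Lemma order_conj a x y : le (conj a x) (conj a y) <-> le x y.
Proof.
split; last exact: order_mul.
by move=> /(order_mul a^-1 a); rewrite /conj !mulgA mulVg !mul1g !mulgVK.
Qed.

Lemma mull_symmetry a : order_symmetry le ( *%g a) ( *%g a^-1).
Proof. by split; [exact: mulKg|exact: mulVKg|left; exact: order_mull]. Qed.

Lemma inv_symmetry : order_symmetry le (fun x => x^-1) (fun x => x^-1).
Proof.
have sub x y : le x y -> le y^-1 x^-1.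
  by move=> /(order_mul x^-1 y^-1); rewrite mulVg mul1g mulgK.
split; [exact: invgK|exact: invgK|right=> x y; split=> /sub //].
by rewrite !invgK.
Qed.

Lemma conj_symmetry a : order_symmetry le (conj a) (conj a^-1).
Proof. by split; [exact: conjK|exact: conjVK|left; exact: order_conj]. Qed.

Lemma strong_lcoset g M : strong M -> strong (lcoset g M).
Proof. exact: strong_image (mull_symmetry g). Qed.

(** If [z] were outside [M], then [le z b] would give [le z a], and antisymmetry would put [z] back
    in [M]. *)
Lemma strong_convex M : strong M -> convex le M.
Proof.
move=> [modM _ _] a z b Ma Mb az zb; apply: contrapT => Mz.
have [zab _] := module_alike modM (I : [set: G] z) Mz Ma Mb.
by apply: Mz; rewrite -(order_antisym _ _ az (zab.2 zb)).
Qed.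

Lemma span_strong g : strong (S g).
Proof. exact: strong_span_strong. Qed.

(** [M] and its inverse are strong through [1], hence nested; inversion being an involution, either
    inclusion is an equality. *)
Lemma strong_inv M : strong M -> M 1 -> [set x^-1 | x in M] = M.
Proof.
move=> sM M1; have sMV := strong_image M inv_symmetry sM.
have VM A : [set x^-1 | x in [set x^-1 | x in A]] = A :> set G.
  rewrite image_comp -[RHS]image_id; congr image; apply/funext => x /=.
  exact: invgK.
have [MV|VM'] := strong_chain 1 _ _ sM sMV M1 (ex_intro2 _ _ 1 M1 (invg1 G)).
  by apply/seteqP; split=> //; rewrite -{2}[M]VM; exact: image_subset.
by apply/seteqP; split=> //; rewrite -{1}[M]VM; exact: image_subset.
Qed.

Lemma span_inv g : S g^-1 = S g.
Proof.
have := strong_span_image 1 g inv_symmetry.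
by rewrite invg1 strong_inv //; [exact: span_strong|exact: strong_span_l].
Qed.

(** Translation by [g] carries the span of [1] and [g^-1], which is [S g], to the span of [g] and
    [1]. *)
Lemma span_lcoset g : lcoset g (S g) = S g.
Proof.
rewrite -{1}span_inv [LHS](strong_span_image 1 g^-1 (mull_symmetry g)) mulg1 mulgV.
by apply/seteqP; split; apply: strong_span_sub;
  first [exact: strong_span_l|exact: strong_span_r|exact: strong_span_strong].
Qed.

(** If [y] is in [S x], the spans [S x] and [S y] agree. Otherwise [S x] lies in the span of [x] and
    [y], which thus contains [1] and equals [S y]. *)
Lemma span_stable y x : S y x -> lcoset x (S y) = S y.
Proof.
move=> Sx; have sxy : strong (strong_span [set: G] le x y) by exact: strong_span_strong.
have [Sxy|Sxy] := pselect (S x y).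
  have -> : S y = S x; last exact: span_lcoset.
  apply/seteqP; split; apply: strong_span_sub => //;
    first [exact: strong_span_l|exact: span_strong].
have {sxy}eS : strong_span [set: G] le x y = S y.
  apply/seteqP; split.
    by apply: strong_span_sub => //; [exact: span_strong|exact: strong_span_r].
  apply: strong_span_sub => //; last exact: strong_span_r.
  have [sub|sub] := strong_chain x _ _ (span_strong x) sxy (strong_span_r _ _)
      (strong_span_l _ _).
    by apply: sub; exact: strong_span_l.
  by exfalso; apply: Sxy; apply: sub; exact: strong_span_r.
(* With [w = x^-1 * y], the translates of [S w] by [x] and by [y = x * w] both equal [S y], which is
   also its own translate by [y]. Cancelling [y] gives [S w = S y]. *)
have eSx : lcoset x (S (x^-1 * y)) = S y.
  by rewrite [LHS](strong_span_image 1 _ (mull_symmetry x)) mulg1 mulVKg.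
have eSy : lcoset y (S (x^-1 * y)) = S y.
  by rewrite -[RHS]eSx -[in RHS](span_lcoset (x^-1 * y)) lcosetM mulVKg.
have lcosetI : lcoset y^-1 (lcoset y (S (x^-1 * y))) = lcoset y^-1 (lcoset y (S y)).
  by rewrite eSy span_lcoset.
rewrite !lcosetM mulVg !lcoset1 in lcosetI.
by rewrite -{1}lcosetI.
Qed.

(** The larger of [S x] and [S y] contains both points, lies in [M], and is stable under translation
    by [x]. *)
Lemma strong_subgroup M : strong M -> M 1 -> subgroup M.
Proof.
move=> sM M1; apply/subgroupP; split=> // x y Mx My.
have [z [Mz Sx Sy]] : exists z, [/\ M z, S z x & S z y].
  have [Sxy|Syx] := strong_chain 1 _ _ (span_strong x) (span_strong y)
      (strong_span_l _ _) (strong_span_l _ _).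
    by exists y; split=> //; [apply: Sxy|]; exact: strong_span_r.
  by exists x; split=> //; [|apply: Syx]; exact: strong_span_r.
apply: (strong_span_sub M sM M1 Mz); apply/lcosetE.
by rewrite (span_stable z x).
Qed.

Lemma chain_strong H : V H -> strong H /\ H 1.
Proof. by move=> [g _ <-]; split; [exact: span_strong|exact: strong_span_l]. Qed.

Lemma chain_span g : g <> 1 -> V (S g).
Proof. by exists g. Qed.

Lemma chain_total : total_on V (fun H K => H `<=` K).
Proof.
move=> H K /chain_strong[sH H1] /chain_strong[sK K1].
exact: strong_chain sH sK H1 K1.
Qed.

(** The singleton of [1] is itself strong; counting it as a member also covers the empty family. *)
Lemma strong_union1 (F : set (set G)) : F `<=` V -> strong (union1 F) /\ union1 F 1.
Proof.
move=> FV; split; last by left.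
have -> : union1 F = \bigcup_(H in [set 1] |` F) H by rewrite bigcup_setU1.
apply: (@strong_bigcup _ _ _ 1); first by exists [set 1]; left.
by move=> H [->|/FV/chain_strong//]; split=> //; exact: strong_set1.
Qed.

Lemma strong_union1E M : strong M -> M 1 -> M = union1 [set H | V H /\ H `<=` M].
Proof.
move=> sM M1; apply/seteqP; split=> [x Mx|x [->//|[H [_ HM]]]]; last exact: HM.
have [->|x1] := pselect (x = 1); first by left.
right; exists (S x); last exact: strong_span_r.
by split; [exact: chain_span|exact: strong_span_sub].
Qed.

Lemma strong_initial_segment M :
  (strong M /\ M 1) <->
  exists2 I : set (set G), initial_segment I V & M = union1 I.
Proof.
split=> [[sM M1]|[I [IV _] ->]]; last exact: strong_union1.
exists [set H | V H /\ H `<=` M]; last exact: strong_union1E.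
split=> [H []//|H K [_ HM] VK KH]; split=> //; exact: subset_trans HM.
Qed.

Lemma strong_is_lcoset M : strong M ->
  exists (C : set G) (g : G),
    [/\ strong C, C 1, subgroup C, convex le C & M = lcoset g C].
Proof.
move=> sM; have [_ [g Mg] _] := sM.
have sC := strong_lcoset g^-1 _ sM.
have C1 : lcoset g^-1 M 1 by apply/lcosetE; rewrite invgK mulg1.
exists (lcoset g^-1 M), g; split=> //; [exact: strong_subgroup|exact: strong_convex|].
by rewrite lcosetM mulgV lcoset1.
Qed.

Lemma lower_strong H : strong (lower le H) /\ lower le H 1.
Proof. by apply: strong_union1 => K []. Qed.

Lemma lower_subgroup H : subgroup (lower le H).
Proof. by have [sN N1] := lower_strong H; exact: strong_subgroup. Qed.

(** Each span contained in [M] is a chain member strictly below [H], and [M] is the union of these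
    spans with [1]. *)
Lemma sub_lower H M : strong M -> M 1 -> M `<` H -> M `<=` lower le H.
Proof.
move=> sM M1 MH x Mx; rewrite (strong_union1E _ sM M1) in Mx.
case: Mx => [->|[K [VK KM] Kx]]; first by left.
right; exists K => //; split=> //; case: MH => MH HM; split; first exact: subset_trans MH.
by move=> HK; apply: HM; exact: subset_trans KM.
Qed.

(** A strong module through [1] and [g] contains [S g], so it cannot lie strictly below it. *)
Lemma lower_span g : g <> 1 -> ~ lower le (S g) g.
Proof.
move=> g1 [//|[K [VK [KS nSK]] Kg]]; apply: nSK.
by have [sK K1] := chain_strong _ VK; exact: strong_span_sub.
Qed.

Lemma lower_proper H : V H -> lower le H `<` H.
Proof.
move=> [g g1 <-]; split=> [x [->|[K [_ [KS _]]]]|SN]; [exact: strong_span_l|exact: KS|].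
by apply: (lower_span _ g1); apply: SN; exact: strong_span_r.
Qed.

Lemma chain_conj a H : V H -> V (conj a @` H).
Proof.
move=> [g g1 <-]; rewrite (strong_span_image 1 g (conj_symmetry a)) conj1.
apply: chain_span => cg; apply: g1.
by rewrite -(conjK a g) cg conj1.
Qed.

Lemma lower_conj a H : lower le (conj a @` H) = conj a @` lower le H.
Proof.
(* Stated for all [b] and [K], so that the reverse inclusion follows by taking [a^-1] for [b]. *)
have sub b K : conj b @` lower le K `<=` lower le (conj b @` K).
  move=> _ [x [->|[L [VL [LK KL]] Lx]] <-]; first by left; rewrite /= conj1.
  right; exists (conj b @` L); last by exists x.
  split; first exact: chain_conj.
  split; first exact: image_subset.
  move=> sub; apply: KL => y Ky; have [|z Lz] := sub (conj b y); first by exists y.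
  by move=> /(can_inj (conjK b)) <-.
apply/seteqP; split=> [x Nx|]; last exact: sub.
exists (conj a^-1 x); last exact: conjVK.
have := sub a^-1 (conj a @` H) (conj a^-1 x).
rewrite image_comp (_ : conj a^-1 \o conj a = id) ?image_id; first by apply; exists x.
by apply/funext => y /=; exact: conjK.
Qed.

Lemma conj_subgroup_image H h : subgroup H -> H h -> conj h @` H = H.
Proof.
have sub k : subgroup H -> H k -> conj k @` H `<=` H.
  move=> HG Hk _ [x Hx <-].
  by apply: subgroupM => //; [exact: subgroupM|exact: subgroupV].
move=> HG Hh; apply/seteqP; split; first exact: sub.
move=> x Hx; exists (conj h^-1 x); last exact: conjVK.
by apply: (sub _ HG (subgroupV HG Hh)); exists x.
Qed.

Lemma chain_subgroup H : V H -> subgroup H.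
Proof. by move=> /chain_strong[sH H1]; exact: strong_subgroup. Qed.

(** Conjugation by an element of [H] fixes [H], and [lower] commutes with conjugation. *)
Lemma lower_normal H : V H -> normal_in (lower le H) H.
Proof.
move=> VH; split=> [||h Hh]; [exact: lower_subgroup|by case: (lower_proper _ VH)|].
by rewrite -lower_conj conj_subgroup_image //; exact: chain_subgroup.
Qed.

End OrderedGroupModules.

(** * The ordered quotients of the chain members *)

Section Quotients.
Context {G : groupType} {le : G -> G -> Prop}.
Hypothesis le_G : group_order_on [set: G] *%g le.
Implicit Types (M N H K : set G) (a b g x : G).

Local Notation strong := (strong_module [set: G] le).
Local Notation S := (strong_span [set: G] le 1).
Local Notation V := (canonical_chain le).

(* Distinct cosets of a strong module are disjoint modules, so any two
   representatives compare in the same way. *)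
Lemma quotient_leE N a b : strong N -> N 1 -> lcoset a N <> lcoset b N ->
  quotient_le le (lcoset a N) (lcoset b N) <-> le a b.
Proof.
move=> sN N1 ab; have NG := strong_subgroup le_G _ sN N1.
split=> [[a' [b' [Na' Nb' a'b']]]|leab].
  2: by exists a, b; split=> //; exact: lcoset_self.
have modC c : is_module [set: G] le (lcoset c N) by case: (strong_lcoset le_G c _ sN).
have Na'b : ~ lcoset b N a'.
  by move=> /(lcoset_eq NG) bE; apply: ab; rewrite -bE; exact/esym/lcoset_eq.
have Nba : ~ lcoset a N b by move=> /(lcoset_eq NG) aE; apply: ab; rewrite -aE.
have [h1 _] := module_alike (modC b) (I : [set: G] a') Na'b Nb' (lcoset_self b NG).
have [_ h2] := module_alike (modC a) (I : [set: G] b) Nba Na' (lcoset_self a NG).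
by apply/h2/h1.
Qed.

Section Quotient.
Context {H : set G}.
Hypothesis VH : V H.
Let N := lower le H.
Let sH : strong H. Proof. by case: (chain_strong _ VH). Qed.
Let HG : subgroup H. Proof. exact: chain_subgroup VH. Qed.
Let sN : strong N. Proof. by case: (lower_strong (le := le) H). Qed.
Let NG : subgroup N. Proof. exact: lower_subgroup. Qed.
Let NH : N `<=` H. Proof. by case: (lower_proper _ VH). Qed.
Let nN : normal_in N H. Proof. exact: lower_normal. Qed.
Let N1 : N 1. Proof. exact: subgroup1. Qed.

Lemma lcoset_lower_sub h : H h -> lcoset h N `<=` H.
Proof. by move=> Hh _ [n /NH Hn <-]; exact: subgroupM. Qed.

(** Translating by [h^-1] brings [M] through [1], where [sub_lower] applies. *)
Lemma sub_lcoset_lower h M : strong M -> M h -> M `<` H -> M `<=` lcoset h N.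
Proof.
move=> sM Mh [MH HM] x Mx; apply/lcosetE.
have Hh := MH _ Mh.
apply: (sub_lower _ (lcoset h^-1 M)).
- exact: strong_lcoset.
- by apply/lcosetE; rewrite invgK mulg1.
- split=> [_ [y /MH Hy <-]|sub]; first by apply: subgroupM => //; exact: subgroupV.
  apply: HM => y Hy; have /sub/lcosetE : H (h^-1 * y).
    by apply: subgroupM => //; exact: subgroupV.
  by rewrite invgK mulVKg.
- by exists x.
Qed.

Lemma lcoset_lower_proper h : H h -> lcoset h N <> H.
Proof.
move=> Hh hNH; have [_ HN] := lower_proper _ VH; apply: HN => x Hx.
have /lcosetE : lcoset h N (h * x) by rewrite hNH; exact: subgroupM.
by rewrite mulKg.
Qed.

(** Every proper strong submodule through [h] lies in the coset of [h], and that coset is one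
    itself. *)
Lemma quotient_maximal_strong : quotient H N = maximal_proper_strong H le.
Proof.
apply/seteqP; split=> [_ [h Hh <-]|M [sM MH maxM]].
  split; [|exact: lcoset_lower_proper|move=> M sM MH hNM].
    apply/(strong_submodule _ _ _ _ sH); split; first exact: strong_lcoset.
    exact: lcoset_lower_sub.
  have [sMG MsH] := (strong_submodule _ _ _ _ sH).1 sM.
  apply/seteqP; split=> //; apply: sub_lcoset_lower => //.
    by apply: hNM; exact: lcoset_self.
  by split=> // HM; apply: MH; apply/seteqP.
have [sMG MsH] := (strong_submodule _ _ _ _ sH).1 sM.
have [_ [h Mh] _] := sM; exists h; first exact: MsH.
apply: maxM; last 1 first.
- apply: sub_lcoset_lower => //.
  by split=> // HM; apply: MH; apply/seteqP.
- apply/(strong_submodule _ _ _ _ sH); split; first exact: strong_lcoset.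
  by apply: lcoset_lower_sub; exact: MsH.
- by apply: lcoset_lower_proper; exact: MsH.
Qed.

Lemma quotient_group : group_on (quotient H N) setmul N.
Proof.
have one : quotient H N N by exists 1; [exact: subgroup1|exact: lcoset1].
have mulE a b : H b -> setmul (lcoset a N) (lcoset b N) = lcoset (a * b) N.
  exact: setmul_lcoset.
have mul1 a : H a -> setmul N (lcoset a N) = lcoset a N.
  by move=> Ha; rewrite -{1}[N]lcoset1 mulE // mul1g.
have mulr1 a : setmul (lcoset a N) N = lcoset a N.
  by rewrite -{2}[N]lcoset1 mulE ?mulg1 //; exact: subgroup1.
split.
- move=> _ _ [a Ha <-] [b Hb <-]; rewrite mulE //.
  by exists (a * b) => //; exact: subgroupM.
- move=> _ _ _ [a Ha <-] [b Hb <-] [c Hc <-].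
  by rewrite !mulE ?mulgA //; exact: subgroupM.
- by split=> // _ [a Ha <-]; rewrite mul1 // mulr1.
- move=> _ [a Ha <-]; have HaV := subgroupV HG Ha.
  by exists (lcoset a^-1 N); [exists a^-1|rewrite !mulE // mulgV mulVg lcoset1].
Qed.

Lemma quotient_le_refl a : quotient_le le (lcoset a N) (lcoset a N).
Proof. by exists a, a; split; try exact: lcoset_self; exact: order_refl. Qed.

Lemma quotient_partial_order : partial_order_on (quotient H N) (quotient_le le).
Proof.
split.
- by move=> _ [a _ <-]; exact: quotient_le_refl.
- move=> _ _ [a _ <-] [b _ <-] leab leba.
  (* Distinct cosets compare as their representatives do, so antisymmetry in [G] would identify the
     representatives. *)
  have ab : lcoset a N <> lcoset b N -> a = b.
    move=> ab; apply: (order_antisym le_G); first exact/(quotient_leE _ _ _ sN N1 ab).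
    by apply/(quotient_leE _ _ _ sN N1) => // ba; apply: ab.
  by apply: contrapT => /[dup]/ab ->.
- move=> _ _ _ [a _ <-] [b _ <-] [c _ <-] ab bc.
  have [->|nab] := pselect (lcoset a N = lcoset b N); first by [].
  have [<-|nbc] := pselect (lcoset b N = lcoset c N); first by [].
  have [<-|nac] := pselect (lcoset a N = lcoset c N); first exact: quotient_le_refl.
  apply/(quotient_leE _ _ _ sN N1 nac)/(order_trans le_G b).
    exact/(quotient_leE _ _ _ sN N1 nab).
  exact/(quotient_leE _ _ _ sN N1 nbc).
Qed.

Lemma quotient_ordered_group :
  ordered_group_on (quotient H N) setmul N (quotient_le le).
Proof.
split; first exact: quotient_group.
split; first exact: quotient_partial_order.
move=> _ _ A B [a _ <-] [b _ <-] _ _ [x [y [Ax By xy]]].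
exists (a * x * b), (a * y * b); split; last exact: order_mul.
  exists (a * x); last by exists b => //; exact: lcoset_self.
  by exists a; [exact: lcoset_self|exists x].
exists (a * y); last by exists b => //; exact: lcoset_self.
  by exists a; [exact: lcoset_self|exists y].
Qed.

Lemma mem_quotient A x : quotient H N A -> A x -> H x /\ A = lcoset x N.
Proof.
move=> [a Ha <-] ax; split; first exact: (lcoset_lower_sub a).
exact/esym/lcoset_eq.
Qed.

(** A coset outside [U] differs from every coset in [U], so by [quotient_leE] the module conditions
    in the quotient and in [H] are the same. *)
Lemma quotient_module (U : set (set G)) : U `<=` quotient H N ->
  is_module (quotient H N) (quotient_le le) U <-> is_module H le (\bigcup_(A in U) A).
Proof.
move=> UQ.
have memU x : (\bigcup_(A in U) A) x <-> U (lcoset x N).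
  split=> [[A UA Ax]|Ux]; last by exists (lcoset x N) => //; exact: lcoset_self.
  by have [_ <-] := mem_quotient _ _ (UQ _ UA) Ax.
have alikeE x m m' : ~ U (lcoset x N) -> U (lcoset m N) -> U (lcoset m' N) ->
    @alike _ (quotient_le le) (lcoset x N) (lcoset m N) (lcoset m' N) <->
    @alike _ le x m m'.
  move=> Ux Um Um'.
  have xm : lcoset x N <> lcoset m N by move=> xm; rewrite xm in Ux.
  have xm' : lcoset x N <> lcoset m' N by move=> xm'; rewrite xm' in Ux.
  have leE a b ab := propext (quotient_leE N a b sN N1 ab).
  by rewrite /alike !leE //; exact: nesym.
split=> modU; split=> //.
- by move=> x [A UA Ax]; have [] := mem_quotient _ _ (UQ _ UA) Ax.
- move=> x [Hx /memU Ux] m m' /memU Um /memU Um'; apply/(alikeE _ _ _ Ux Um Um').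
  by apply: (module_alike modU) => //; exists x.
- move=> _ [[x Hx <-] Ux] A A' /[dup] UA /UQ[m _ mA] /[dup] UA' /UQ[m' _ mA'].
  rewrite -{}mA in UA *; rewrite -{}mA' in UA' *; apply/alikeE => //.
  by apply: (module_alike modU) => //; apply/memU.
Qed.

(** A module [L] of [H] that meets the union without lying in it is itself a union of cosets, hence
    comes from a module of the quotient, to which strongness of [U] applies. *)
Lemma quotient_strong (U : set (set G)) :
  strong_module (quotient H N) (quotient_le le) U ->
  strong_module H le (\bigcup_(A in U) A).
Proof.
move=> sU; have [modU [B UB] _] := sU.
have UQ : U `<=` quotient H N by case: modU.
apply: strong_moduleI.
- exact/quotient_module.
- have [b _ bB] := UQ _ UB; exists b, B => //; rewrite -bB; exact: lcoset_self.
move=> L modL [l [Ll [A UA Al]]] /nonsubset[l' [Ll' Ul']].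
pose L' := [set C | quotient H N C /\ C `<=` L].
have L'Q : L' `<=` quotient H N by move=> C [].
(* The coset is strong in [H]. Were [L] inside it, the coset would be [A], and [l'] would lie in the
   union over [U]. *)
have LC x : L x -> lcoset x N `<=` L.
  move=> Lx; have Hx := module_sub modL Lx.
  have sxN : strong_module H le (lcoset x N).
    apply/(strong_submodule _ _ _ _ sH); split; first exact: strong_lcoset.
    exact: lcoset_lower_sub.
  have [LxN|//] : L `<=` lcoset x N \/ lcoset x N `<=` L.
    by apply: (strong_case _ _ sxN modL); exists x; split=> //; exact: lcoset_self.
  exfalso; apply: Ul'; exists A => //.
  have [_ ->] := mem_quotient _ _ (UQ _ UA) Al.
  by rewrite (lcoset_eq NG (LxN _ Ll)); exact: LxN.
have LE : L = \bigcup_(C in L') C.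
  apply/seteqP; split=> [x Lx|x [C [_ CL] Cx]]; last exact: CL.
  exists (lcoset x N); last exact: lcoset_self.
  by split; [exists x => //; exact: module_sub modL Lx|exact: LC].
have modL' : is_module (quotient H N) (quotient_le le) L'.
  by apply/quotient_module => //; rewrite -LE.
have [L'U|UL'] : L' `<=` U \/ U `<=` L'.
- apply: (strong_case _ _ sU modL'); exists A; split=> //; split; first exact: UQ.
  by have [_ ->] := mem_quotient _ _ (UQ _ UA) Al; exact: LC.
- exfalso; apply: Ul'; move: Ll'; rewrite {1}LE => -[C L'C Cl'].
  by exists C => //; exact: L'U.
- by move=> x [C /UL'[_ CL] Cx]; exact: CL.
Qed.

(** A strong module of the quotient pulls back to a strong module of [G]; if that is not all of [H],
    it fits in one coset. *)
Lemma quotient_trichotomy :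
  [\/ is_prime (quotient H N) (quotient_le le),
      total_on (quotient H N) (quotient_le le) |
      equality_ordered (quotient H N) (quotient_le le)].
Proof.
apply: strong_trivial_trichotomy; first exact: quotient_partial_order.
move=> U sU; have [[UQ _] [B UB] _] := sU.
have [sM MH] := (strong_submodule _ _ _ _ sH).1 (quotient_strong _ sU).
have inU x : (\bigcup_(A in U) A) x -> U (lcoset x N).
  by move=> [A UA Ax]; have [_ <-] := mem_quotient _ _ (UQ _ UA) Ax.
have [HM|HM] := pselect (H `<=` \bigcup_(A in U) A).
  left; apply/seteqP; split=> // _ [h Hh <-].
  by apply: inU; exact: HM.
right; have [b _ bB] := UQ _ UB; exists B; apply/seteqP; split=> [C UC|_ -> //].
have [c _ cC] := UQ _ UC; rewrite /= -{}cC -{}bB in UB UC *.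
have Mc : (\bigcup_(A in U) A) c by exists (lcoset c N) => //; exact: lcoset_self.
have Mb : (\bigcup_(A in U) A) b by exists (lcoset b N) => //; exact: lcoset_self.
by apply: lcoset_eq NG _; apply: (sub_lcoset_lower b) Mc.
Qed.

End Quotient.

(** By [lower_span], [g] is not in [N], so its coset differs from [N] and [quotient_leE] applies to
    [1] and [g]. *)
Lemma quotient_compare g (N := lower le (S g)) : g <> 1 ->
  [/\ slt le 1 g <-> slt (quotient_le le) N (lcoset g N),
      slt le g 1 <-> slt (quotient_le le) (lcoset g N) N &
      incomparable le g 1 <-> incomparable (quotient_le le) (lcoset g N) N].
Proof.
move=> g1; have [sN N1] : strong N /\ N 1 by exact: lower_strong.
have NG : subgroup N by exact: lower_subgroup.
have gN : lcoset g N <> lcoset 1 N.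
  by rewrite lcoset1 => gN; move: (lcoset_self g NG); rewrite gN; exact: lower_span.
have := propext (quotient_leE _ _ _ sN N1 gN).
have := propext (quotient_leE _ _ _ sN N1 (nesym gN)).
move: gN; rewrite !lcoset1 => gN leN geN.
by rewrite /slt /incomparable leN geN; split; split=> // -[? _]; split=> //; exact: nesym.
Qed.

(** The isomorphism is the direct image under [conj a], undone by the direct image under
    [conj a^-1]. *)
Lemma chain_quotient_iso a H : V H ->
  exists2 f : set G -> set G,
    (forall g, H g -> f (lcoset g (lower le H)) =
       lcoset (conj a g) (lower le (conj a @` H))) &
    ordered_group_iso
      (quotient H (lower le H)) setmul (quotient_le le)
      (quotient (conj a @` H) (lower le (conj a @` H))) setmul
      (quotient_le le) f.
Proof.
move=> VH; exists (fun A => conj a @` A) => [g _|].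
  by rewrite conj_image_lcoset lower_conj.
have imK A : conj a^-1 @` (conj a @` A) = A.
  rewrite image_comp -[RHS]image_id; congr image; apply/funext => x.
  exact: conjK.
split; first split.
- move=> _ [h Hh <-]; exists (conj a h); first by exists h.
  by rewrite conj_image_lcoset lower_conj.
- by move=> A B _ _ AB; rewrite -(imK A) AB imK.
- move=> _ [_ [h Hh <-] <-]; exists (lcoset h (lower le H)); first by exists h.
  by rewrite conj_image_lcoset lower_conj.
- move=> A B _ _; apply/seteqP; split=> [_ [_ [x Ax [y By <-]] <-]|].
    by exists (conj a x); [exists x|exists (conj a y); [exists y|rewrite conjM]].
  move=> _ [_ [x Ax <-] [_ [y By <-] <-]]; exists (x * y); last exact: conjM.
  by exists x => //; exists y.
- move=> A B _ _; split=> [[x [y [Ax By xy]]]|[_ [_ [[x Ax <-] [y By <-] xy]]]].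
    exists (conj a x), (conj a y).
    by split; [exists x|exists y|exact/(order_conj le_G)].
  by exists x, y; split=> //; exact/(order_conj le_G a).
Qed.

End Quotients.

(** * Recovering the order from the chain and its quotients *)

Lemma span_chain_sub {G : groupType} {le le' : G -> G -> Prop} (g : G) :
  g <> 1 -> canonical_chain le' = canonical_chain le ->
  strong_span [set: G] le 1 g `<=` strong_span [set: G] le' 1 g.
Proof.
move=> g1 eqV.
have : canonical_chain le (strong_span [set: G] le' 1 g) by rewrite -eqV; exists g.
(* As a member of the common chain, the span for [le'] is also strong for [le], so minimality
   applies. *)
move=> /chain_strong[sS S1]; apply: strong_span_sub => //; exact: strong_span_r.
Qed.

(** Translation reduces to comparing [1] with [g = x^-1 * y]. Both orders give [g] the same span and
    the same lower subgroup, so [quotient_compare] reads both comparisons in one quotient. *)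
Lemma order_reconstruction {G : groupType} {le le' : G -> G -> Prop} x y :
  group_order_on [set: G] *%g le -> group_order_on [set: G] *%g le' ->
  canonical_chain le' = canonical_chain le ->
  (forall H, canonical_chain le H ->
    forall A B, quotient H (lower le H) A -> quotient H (lower le H) B ->
    (quotient_le le' A B <-> quotient_le le A B)) ->
  le' x y <-> le x y.
Proof.
move=> le_G le'_G eqV eqQ.
rewrite -(order_mull le_G x^-1 x y) -(order_mull le'_G x^-1 x y) mulVg.
set g := x^-1 * y; have [->|g1] := pselect (g = 1).
  by split=> _; [exact: (order_refl le_G)|exact: (order_refl le'_G)].
pose H := strong_span [set: G] le 1 g; pose N := lower le H.
have HE : strong_span [set: G] le' 1 g = H.
  by apply/seteqP; split; exact: span_chain_sub.
have NE : lower le' H = N by rewrite /N /lower eqV.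
have VH : canonical_chain le H by exists g.
have QN : quotient H N N.
  by exists 1; [exact: strong_span_l|exact: lcoset1].
have QgN : quotient H N (lcoset g N) by exists g => //; exact: strong_span_r.
have [cmp _ _] := quotient_compare le_G g g1.
have [cmp' _ _] := quotient_compare le'_G g g1.
(* Since [g] is not [1], strict and weak comparison with [1] agree. *)
have sltE (l : G -> G -> Prop) : slt l 1 g <-> l 1 g.
  by split=> [[]//|]; split=> //; exact: nesym.
rewrite HE NE /slt in cmp'.
rewrite -(sltE le) -(sltE le').
apply: iff_trans cmp' _; apply: iff_trans (iff_sym cmp).
by rewrite /slt; split=> -[leN ne]; split=> //; exact/(eqQ H VH N (lcoset g N)).
Qed.

Theorem theorem1p1 (G : groupType) (le : G -> G -> Prop)
    (le_G : group_order_on [set: G] *%g le) :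
  (* (a) *)
  [/\ forall M : set G, strong_module [set: G] le M -> M 1 ->
        subgroup M /\ convex le M,
      total_on (canonical_chain le) (fun H K => H `<=` K),
      forall M : set G,
        (strong_module [set: G] le M /\ M 1) <->
        exists2 I : set (set G),
          initial_segment I (canonical_chain le) & M = union1 I &
      forall M : set G, strong_module [set: G] le M ->
        exists (C : set G) (g : G),
          [/\ strong_module [set: G] le C, C 1, subgroup C, convex le C &
              M = lcoset g C]] /\
  (* (b) *)
  (forall H : set G, canonical_chain le H ->
     [/\ lower le H `<` H,
         convex le (lower le H),
         normal_in (lower le H) H,
         quotient H (lower le H) = maximal_proper_strong H le &
         ordered_group_on (quotient H (lower le H)) setmul (lower le H)
           (quotient_le le) /\
         [\/ is_prime (quotient H (lower le H)) (quotient_le le),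
             total_on (quotient H (lower le H)) (quotient_le le) |
             equality_ordered (quotient H (lower le H)) (quotient_le le)]]) /\
  (* (c) *)
  [/\ forall g : G, g <> 1 ->
        let N := lower le (strong_span [set: G] le 1 g) in
        [/\ slt le 1 g <-> slt (quotient_le le) N (lcoset g N),
            slt le g 1 <-> slt (quotient_le le) (lcoset g N) N &
            incomparable le g 1 <-> incomparable (quotient_le le) (lcoset g N) N],
      forall le' : G -> G -> Prop,
        group_order_on [set: G] *%g le' ->
        canonical_chain le' = canonical_chain le ->
        (forall H : set G, canonical_chain le H ->
           forall A B, quotient H (lower le H) A -> quotient H (lower le H) B ->
             (quotient_le le' A B <-> quotient_le le A B)) ->
        forall x y, le' x y <-> le x y &
      forall (a : G) (H : set G), canonical_chain le H ->
        [/\ canonical_chain le (conj a @` H),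
            lower le (conj a @` H) = conj a @` lower le H &
            exists2 f : set G -> set G,
              (forall g, H g ->
                 f (lcoset g (lower le H)) =
                 lcoset (conj a g) (lower le (conj a @` H))) &
              ordered_group_iso
                (quotient H (lower le H)) setmul (quotient_le le)
                (quotient (conj a @` H) (lower le (conj a @` H))) setmul
                (quotient_le le) f]].
Proof.
split; [|split=> [H VH|]].
- split.
  + by move=> M sM M1; split; [exact: (strong_subgroup le_G)|exact: (strong_convex le_G)].
  + exact: chain_total.
  + exact: strong_initial_segment.
  + exact: (strong_is_lcoset le_G).
- have [sN _] := lower_strong (le := le) H.
  split.
  + exact: lower_proper.
  + exact: (strong_convex le_G).
  + exact: (lower_normal le_G).
  + exact: (quotient_maximal_strong le_G).
  + by split; [exact: (quotient_ordered_group le_G)|exact: (quotient_trichotomy le_G)].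
- split.
  + by move=> g g1; exact: (quotient_compare le_G).
  + by move=> le' le'_G eqV eqQ x y; exact: (order_reconstruction _ _ le_G).
  + move=> a H VH; split.
    * exact: (chain_conj le_G).
    * exact: (lower_conj le_G).
    * exact: (chain_quotient_iso le_G).
Qed.
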